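(* For any adaptive strategy tree $\mathcal{T}$ and any monotone non-negative submodular function $f:2^X\to\mathbb{R}_{\ge0}$ with $f(\emptyset)=0$, \[ \mathrm{alg}(\mathcal{T},f)\ \ge\ \tfrac13\,\mathrm{adap}(\mathcal{T},f). \]
   Context: Ground set $X$; each $e\in X$ has probability $p_e$, $q_e=1-p_e$. An adaptive strategy tree $\mathcal{T}$ is a rooted binary tree whose internal nodes $v$ are labelled by elements $\mathrm{elt}(v)\in X$, each with a yes-arc and a no-arc, with no element labelling two nodes on a root-leaf path. It induces a distribution $\pi_{\mathcal{T}}$ over leaves: starting at the root, at node $v$ follow the yes-arc with probability $p_{\mathrm{elt}(v)}$ and the no-arc otherwise. For a leaf $\ell$, let $P_\ell$ be its root path, $\mathrm{elt}(P_\ell)$ the elements labelling nodes on it, and $A_\ell$ the elements on $P_\ell$ whose yes-arc is taken on $P_\ell$. For a set function $f$ let $f^{\max}(S)=\max_{T\subseteq S}f(T)$. Define $\mathrm{adap}(\mathcal{T},f):=\mathbb{E}_{\ell\leftarrow\pi_{\mathcal{T}}}[f^{\max}(A_\ell)]$ and $\mathrm{alg}(\mathcal{T},f):=\mathbb{E}_{\ell\leftarrow\pi_{\mathcal{T}}}\big[\mathbb{E}_{R}[f^{\max}(R\cap\mathrm{elt}(P_\ell))]\big]$, where $R\subseteq X$ contains each $e$ independently with probability $p_e$ (independently of $\ell$). *)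

(* Defs.v *)
From mathcomp Require Import all_boot all_order all_algebra.

Set Implicit Arguments.
Unset Strict Implicit.
Unset Printing Implicit Defensive.

Import Order.TTheory GRing.Theory Num.Theory.
Local Open Scope ring_scope.

(* [Node e y n] is an internal node labelled by [e], whose yes-arc leads to
   [y] and whose no-arc leads to [n]. *)
Inductive tree (X : Type) : Type :=
| Leaf
| Node of X & tree X & tree X.
Arguments Leaf {X}.

(* A leaf is represented by its root path: the sequence of arcs followed from
   the root, each arc being the label of the node it leaves together with
   [true] for a yes-arc and [false] for a no-arc. *)
Definition rpath (X : Type) : Type := seq (X * bool).

Fixpoint leaves (X : Type) (T : tree X) : seq (rpath X) :=
  match T with
  | Leaf => [:: [::]]
  | Node e y n =>
      [seq (e, true) :: l | l <- leaves y] ++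
      [seq (e, false) :: l | l <- leaves n]
  end.

Definition strategy_tree (X : eqType) (T : tree X) : Prop :=
  forall l : rpath X, l \in leaves T -> uniq (unzip1 l).

Section Strategy.
Variables (R : realFieldType) (X : finType).
Implicit Types (p : X -> R) (f : {set X} -> R) (l : rpath X) (T : tree X).

Definition elts l : {set X} := [set e | e \in unzip1 l].

Definition active l : {set X} := [set e | (e, true) \in l].

Definition leaf_prob p l : R :=
  \prod_(a <- l) (if a.2 then p a.1 else 1 - p a.1).

Definition subset_prob p (S : {set X}) : R :=
  (\prod_(e in S) p e) * \prod_(e in ~: S) (1 - p e).

(* The default value [f set0] is itself one of the values being maximised. *)
Definition fmax f (S : {set X}) : R :=
  \big[Num.max/f set0]_(U : {set X} | U \subset S) f U.

Definition adap p T f : R :=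
  \sum_(l <- leaves T) leaf_prob p l * fmax f (active l).

Definition alg p T f : R :=
  \sum_(l <- leaves T) leaf_prob p l *
    \sum_(S : {set X}) subset_prob p S * fmax f (S :&: elts l).

Definition set_monotone f : Prop :=
  forall A B : {set X}, A \subset B -> f A <= f B.

Definition submodular f : Prop :=
  forall A B : {set X}, f (A :|: B) + f (A :&: B) <= f A + f B.

End Strategy.

(* Main.v *)
Require Import Defs.
From mathcomp Require Import all_boot all_order all_algebra.
From mathcomp Require Import ring lra.

Import Order.TTheory GRing.Theory Num.Theory.
Local Open Scope ring_scope.

(** Couple the leaf with the independent sample by revealing both along the
    root path: let A be the elements seen active and S the sampled elements of
    the path so far.  When the tree probes [e], whether [e] becomes active is
    independent of S, so the expected gain of [e] over S is the same for A and
    for S.  Hence in expectation f(A) <= f(A :|: S) <= 2 f(S) at the leaf, which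
    is even better than the factor 3. *)

Section AdaptivityGap.
Variables (R : realFieldType) (X : finType) (p : X -> R).
Implicit Types (f g : {set X} -> R) (S A B U : {set X}) (l : rpath X).

Lemma fmax_monotone f S : set_monotone f -> fmax f S = f S.
Proof.
move=> f_mono; apply/eqP; rewrite eq_le /fmax; apply/andP; split.
  apply: (big_ind (fun x => x <= f S)) => [|x y xS yS|U US].
  - exact/f_mono/sub0set.
  - by rewrite ge_max xS.
  - exact: f_mono.
by rewrite (bigD1 S) //= le_max lexx.
Qed.

Lemma subset_probE S :
  subset_prob p S = \prod_e (if e \in S then p e else 1 - p e).
Proof.
rewrite /subset_prob [RHS](bigID (mem S)) /=; congr (_ * _).
  by apply: eq_bigr => e ->.
by apply: eq_big => e; rewrite inE // => /negPf ->.
Qed.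

Lemma sum_subset_prob : \sum_S subset_prob p S = 1.
Proof.
under eq_bigr do rewrite subset_probE.
transitivity (\prod_e (p e + (1 - p e))); last first.
  by rewrite big1 // => e _; rewrite addrC subrK.
by rewrite bigA_distr.
Qed.

Lemma sum_set_split e (g : {set X} -> R) :
  \sum_S g S = \sum_(S : {set X} | e \notin S) (g S + g (e |: S)).
Proof.
rewrite (bigID (fun S : {set X} => e \in S)) /= addrC big_split /=; congr (_ + _).
rewrite (reindex_onto (fun S : {set X} => e |: S) (fun S => S :\ e)) /=; last first.
  by move=> S; exact: setD1K.
apply: eq_bigl => S; rewrite setU11 /=.
apply/eqP/idP => [<-|eS]; first by rewrite setD11.
exact: setU1K.
Qed.

(** Conditioning on the coin of [e]: once [e] is forced in or out, that coin no longer matters, so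
    both conditional means remain sums over the full distribution. This lets the sample be revealed
    one element at a time. *)
Lemma sum_subset_prob_condition e g :
  \sum_S subset_prob p S * g S =
  p e * (\sum_S subset_prob p S * g (e |: S)) +
  (1 - p e) * (\sum_S subset_prob p S * g (S :\ e)).
Proof.
rewrite !(sum_set_split e) !mulr_sumr -big_split /=.
apply: eq_bigr => S eS.
rewrite setUA setUid setU1K // (setDidPl _); last first.
  by rewrite disjoint_sym disjoints1.
(* The weight of all coins but that of [e], shared by [S] and [e |: S]. *)
pose w := \prod_(i | i != e) (if i \in S then p i else 1 - p i).
have -> : subset_prob p S = (1 - p e) * w.
  by rewrite subset_probE (bigD1 e) //= (negPf eS).
have -> : subset_prob p (e |: S) = p e * w.
  rewrite subset_probE (bigD1 e) //= setU11; congr (_ * _).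
  by apply: eq_bigr => i /negPf ie; rewrite !inE ie.
ring.
Qed.

(** The arcs taken are ignored: each label on the path gets a fresh coin, and [S] accumulates the
    labels sampled so far. *)
Fixpoint resample f l S : R :=
  if l is (e, _) :: l' then
    p e * resample f l' (e |: S) + (1 - p e) * resample f l' S
  else f S.

Lemma resampleE f l S : uniq (unzip1 l) ->
  \sum_B subset_prob p B * f (S :|: (B :&: elts l)) = resample f l S.
Proof.
elim: l S => [|[e b] l IHl] S /=.
  rewrite -[RHS]mul1r -sum_subset_prob mulr_suml => _.
  apply: eq_bigr => B _; congr (_ * f _).
  by apply/setP => x; rewrite !inE andbF orbF.
(* As [e] does not recur in [l], forcing it in or out leaves [B :&: elts l] unchanged. *)
move=> /andP[el ul]; rewrite -!IHl // [LHS](sum_subset_prob_condition e).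
congr (_ * _ + _ * _); apply: eq_bigr => B _; congr (_ * f _);
  apply/setP => x; rewrite !inE; case: eqP => [->|_] //=;
  by rewrite ?(negPf el) ?orbT ?orbF ?andbF ?orbF.
Qed.

Definition tree_resample f (T : tree X) S : R :=
  \sum_(l <- leaves T) leaf_prob p l * resample f l S.

Definition tree_adap f (T : tree X) A : R :=
  \sum_(l <- leaves T) leaf_prob p l * f (A :|: active l).

Lemma leaf_prob_cons e b l :
  leaf_prob p ((e, b) :: l) = (if b then p e else 1 - p e) * leaf_prob p l.
Proof. by rewrite /leaf_prob big_cons. Qed.

(** Two independent coins for [e]: one picks the subtree, the other decides whether [e] joins
    [S]. *)
Lemma tree_resample_node f e (y n : tree X) S :
  tree_resample f (Node e y n) S =
  p e * (p e * tree_resample f y (e |: S) + (1 - p e) * tree_resample f y S) +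
  (1 - p e) *
    (p e * tree_resample f n (e |: S) + (1 - p e) * tree_resample f n S).
Proof.
rewrite /tree_resample /= big_cat !big_map /= !mulr_sumr -!big_split /=.
rewrite !mulr_sumr; congr (_ + _); apply: eq_bigr => l _;
  rewrite leaf_prob_cons; ring.
Qed.

Lemma tree_adap_node f e (y n : tree X) A :
  tree_adap f (Node e y n) A =
  p e * tree_adap f y (e |: A) + (1 - p e) * tree_adap f n A.
Proof.
rewrite /tree_adap /= big_cat !big_map !mulr_sumr /=.
congr (_ + _); apply: eq_bigr => l _; rewrite leaf_prob_cons -mulrA;
  congr (_ * (_ * f _)); apply/setP => x; rewrite !inE !xpair_eqE ?andbT ?andbF //.
by rewrite orbCA orbA.
Qed.

Hypothesis p_prob : forall e, 0 <= p e <= 1.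

(* The first two terms are the marginal value of A over S; the probe of [e]
   raises them by at most the amount by which it raises the expected [f S]. *)
Lemma tree_adap_le f (T : tree X) A S :
  set_monotone f -> submodular f ->
  tree_adap f T A <= f (A :|: S) - f S + 2 * tree_resample f T S - f S.
Proof.
move=> f_mono f_sub; elim: T A S => [|e y IHy n IHn] A S.
  rewrite /tree_adap /tree_resample /= !big_seq1 /leaf_prob big_nil !mul1r /=.
  have -> : active [::] = set0 :> {set X} by apply/setP => x; rewrite !inE.
  rewrite setU0; have := f_mono _ _ (subsetUl A S); lra.
rewrite tree_adap_node tree_resample_node.
have gain : f (e |: (A :|: S)) + f S <= f (A :|: S) + f (e |: S).
  have := f_sub (A :|: S) (e |: S).
  have -> : (A :|: S) :|: (e |: S) = e |: (A :|: S).
    by apply/setP => x; rewrite !inE; case: (x \in S); rewrite !(orbT, orbF) // orbC.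
  (* The intersection in the submodular inequality contains [S], so monotonicity bounds its value
     below by [f S]. *)
  by apply: le_trans; rewrite lerD2l f_mono // subsetI subsetUr subsetUr.
have := IHy (e |: A) (e |: S); have := IHy (e |: A) S.
have := IHn A (e |: S); have := IHn A S.
rewrite -setUUr setUCA -setUA.
have grow := f_mono _ _ (subsetUr [set e] S).
move: gain grow (p_prob e); move: (p e) => q gain grow /andP[q0 q1].
have q1' : 0 <= 1 - q by rewrite subr_ge0.
move=> n0 n1 y0 y1.
(* Average the induction hypotheses over the four outcomes of the two coins. *)
have {y0 y1} := ler_wpM2l q0 (lerD (ler_wpM2l q0 y1) (ler_wpM2l q1' y0)).
have {n0 n1} := ler_wpM2l q1' (lerD (ler_wpM2l q0 n1) (ler_wpM2l q1' n0)).
(* [e] is added to [A :|: S] with probability [q * q + 2 * q * (1 - q)], whereas the doubled sample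
   gains with weight [2 * q]; the excess [q * q] is covered by [grow]. *)
have := ler_wpM2l (mulr_ge0 q0 q0) gain.
have := ler_wpM2l (mulr_ge0 q0 q1') gain.
have := ler_wpM2l (mulr_ge0 q0 q0) grow.
lra.
Qed.

Lemma adap_le_2alg f (T : tree X) : strategy_tree T ->
  set_monotone f -> submodular f -> f set0 = 0 ->
  adap p T f <= 2 * alg p T f.
Proof.
move=> T_strat f_mono f_sub f0.
have -> : adap p T f = tree_adap f T set0.
  by apply: eq_bigr => l _; rewrite fmax_monotone // set0U.
have -> : alg p T f = tree_resample f T set0.
  rewrite /alg /tree_resample !big_seq; apply: eq_bigr => l lT.
  rewrite -resampleE; last exact: T_strat.
  by congr (_ * _); apply: eq_bigr => B _; rewrite fmax_monotone // set0U.
(* Starting from empty sets, every term but the doubled resampling value is [f set0 = 0]. *)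
have := tree_adap_le f T set0 set0 f_mono f_sub.
by rewrite set0U f0 !subr0 add0r.
Qed.

Lemma alg_ge0 f (T : tree X) : (forall S, 0 <= f S) -> set_monotone f ->
  0 <= alg p T f.
Proof.
move=> f_ge0 f_mono.
have q_ge0 e b : 0 <= (if b then p e else 1 - p e).
  by case/andP: (p_prob e) => ? ?; case: b; rewrite ?subr_ge0.
apply: sumr_ge0 => l _; apply: mulr_ge0; first exact: prodr_ge0.
apply: sumr_ge0 => S _; rewrite fmax_monotone // mulr_ge0 //.
by rewrite subset_probE prodr_ge0.
Qed.

End AdaptivityGap.

Theorem theorem5 (R : realFieldType) (X : finType) (p : X -> R)
  (p_prob : forall e : X, 0 <= p e <= 1)
  (T : tree X) (T_strategy : strategy_tree T)
  (f : {set X} -> R)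
  (f_ge0 : forall S : {set X}, 0 <= f S)
  (f_mono : set_monotone f)
  (f_submod : submodular f)
  (f_set0 : f set0 = 0) :
  alg p T f >= 3%:R^-1 * adap p T f.
Proof.
have := adap_le_2alg _ _ _ p_prob _ _ T_strategy f_mono f_submod f_set0.
(* Nonnegativity of [alg] relaxes the factor 2 to 3. *)
have := alg_ge0 _ _ _ p_prob _ T f_ge0 f_mono.
lra.
Qed.
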